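(* Every (finite simple) graph belongs to some minimal DSF set.
   Context: All graphs are finite and simple, considered up to isomorphism. For a set $\mathcal{F}$ of graphs, a graph is $\mathcal{F}$-free if none of its induced subgraphs is isomorphic to a member of $\mathcal{F}$. A set $\mathcal{F}$ of graphs is degree-sequence-forcing (DSF) if whenever some realization of a degree sequence $d$ (a graph with degree sequence $d$) is $\mathcal{F}$-free, every realization of $d$ is $\mathcal{F}$-free. A DSF set is minimal if no proper subset of it is DSF.
   Formalization: Since the empty set is vacuously DSF, no nonempty set would be minimal under the literal definition; here a DSF set is called minimal if no nonempty proper subset of it is DSF. *)

(* Defs.v *)
From mathcomp Require Import all_boot.

Set Implicit Arguments.
Unset Strict Implicit.
Unset Printing Implicit Defensive.

Record sgraph := SGraph {
  vertex :> finType;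
  adj : rel vertex;
  adj_sym : symmetric adj;
  adj_irrefl : irreflexive adj
}.

Definition iso (G H : sgraph) : Prop :=
  exists2 f : G -> H, bijective f & forall x y, adj (f x) (f y) = adj x y.

Section Induced.
Variables (G : sgraph) (S : {set G}).

Definition induced_adj : rel {x : G | x \in S} :=
  fun u v => adj (val u) (val v).

Lemma induced_sym : symmetric induced_adj.
Proof. by move=> u v; apply: adj_sym. Qed.

Lemma induced_irrefl : irreflexive induced_adj.
Proof. by move=> u; apply: adj_irrefl. Qed.

Definition induced : sgraph := SGraph induced_sym induced_irrefl.
End Induced.

Definition deg (G : sgraph) (x : G) : nat := #|[set y | adj x y]|.

Definition degseq (G : sgraph) : seq nat := sort geq [seq deg x | x : G].

Definition realizes (G : sgraph) (d : seq nat) : Prop := degseq G = d.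

(* Predicates rather than mathcomp.classical's [set sgraph]: sgraph quantifies
   over finType and so lives in a universe too large for [set]. *)
Definition graph_set := sgraph -> Prop.

Definition subset_of (F' F : graph_set) : Prop := forall G, F' G -> F G.

Definition proper_subset_of (F' F : graph_set) : Prop :=
  subset_of F' F /\ ~ subset_of F F'.

Definition free (F : graph_set) (G : sgraph) : Prop :=
  forall (S : {set G}) (H : sgraph), F H -> ~ iso (induced S) H.

Definition DSF (F : graph_set) : Prop :=
  forall d : seq nat,
    (exists2 G, realizes G d & free F G) ->
    forall G, realizes G d -> free F G.

(* Graphs are considered up to isomorphism: a set of graphs in the sense of
   the text is an isomorphism-invariant set of concrete graphs. *)
Definition iso_closed (F : graph_set) : Prop :=
  forall G H, iso G H -> F G -> F H.

(* The empty set satisfies DSF vacuously, so minimality is taken among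
   nonempty sets of graphs; otherwise the empty set would be the only minimal
   one. *)
Definition minimal_DSF (F : graph_set) : Prop :=
  DSF F /\
  forall F' : graph_set,
    iso_closed F' -> (exists G, F' G) -> proper_subset_of F' F -> ~ DSF F'.

(* Main.v *)
Require Import Defs.
From Stdlib Require Import Classical.
From mathcomp Require Import all_boot.

Set Implicit Arguments.
Unset Strict Implicit.
Unset Printing Implicit Defensive.

(** Fix thresholds [g i >= 2] and let [F] be the set of minimal graphs whose
    degree sequence dominates [g]; domination depends on degrees only, so [F] is
    DSF. It is also minimal. Given [H], let [A(H)] be [H] plus a matching on
    its darts and [B(H)] the star forest hanging the darts from their sources;
    they have equal degrees. If [F'] is a nonempty DSF subset of [F] and
    [H] is in [F'], then [B(H)] contains a member of [F'], which must be the
    disjoint union [T] of stars with [g i] leaves. For every [J] in [F],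
    [B(J)] contains [T], so [A(J)] contains a member of [F'], which must be [J].

    Taking for [g] the degrees of [G] that exceed 1, [G] lies in [F] as soon as
    every vertex has degree at least 2 or a neighbour of degree at least 2.
    With three or more vertices, this holds for [G] or for its complement, and
    complementation preserves minimal DSF sets. On at most two vertices, [G] or
    its complement forms a DSF set by itself. *)

(** * Induced embeddings and freeness *)

Definition emb (G H : sgraph) : Prop :=
  exists2 f : G -> H, injective f & forall x y, adj (f x) (f y) = adj x y.

Lemma iso_refl G : iso G G.
Proof. by exists id => //; exists id. Qed.

Lemma iso_sym G H : iso G H -> iso H G.
Proof.
move=> [f [f' fK f'K] fA]; exists f'; first by exists f.
by move=> x y; rewrite -fA !f'K.
Qed.

Lemma iso_emb G H : iso G H -> emb G H.
Proof. by move=> [f bf fA]; exists f => //; apply: bij_inj. Qed.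

Lemma emb_trans G H K : emb G H -> emb H K -> emb G K.
Proof.
move=> [f fi fA] [h hi hA]; exists (h \o f) => [|x y /=]; first exact: inj_comp.
by rewrite hA fA.
Qed.

Lemma iso_trans G H K : iso G H -> iso H K -> iso G K.
Proof.
move=> [f fi fA] [h hi hA]; exists (h \o f) => [|x y /=]; first exact: bij_comp.
by rewrite hA fA.
Qed.

Lemma emb_card_iso G H : emb G H -> #|H| <= #|G| -> iso G H.
Proof. by move=> [f fi fA] le; exists f => //; apply: inj_card_bij. Qed.

Lemma emb_card G H : emb G H -> #|G| <= #|H|.
Proof. by move=> [f fi _]; apply: leq_card fi. Qed.

Lemma induced_emb (G : sgraph) (S : {set G}) : emb (induced S) G.
Proof. by exists val => //; apply: val_inj. Qed.

Lemma emb_induced (G H : sgraph) : emb H G -> exists S : {set G}, iso (induced S) H.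
Proof.
move=> [f fi fA]; exists [set f x | x in H]; apply: iso_sym.
have fS x : f x \in [set f x | x in H] by apply/imsetP; exists x.
pose h x : induced [set f x | x in H] := exist _ (f x) (fS x).
have hi : injective h by move=> x y /(congr1 val) /= /fi.
exists h; last by move=> x y; rewrite -fA.
apply: inj_card_bij hi _; rewrite card_sig -(card_imset predT fi).
by apply: eq_leq; apply: eq_card => x; rewrite !inE.
Qed.

(** Embeddings compose directly, unlike vertex subsets, so freeness is handled in this form
    below. *)
Lemma freeP F G : free F G <-> (forall H, F H -> ~ emb H G).
Proof.
split=> [fr H FH /emb_induced [S iS]|fr S H FH iS]; first exact: (fr S H).
by apply: (fr H FH); apply: emb_trans (iso_emb (iso_sym iS)) (induced_emb S).
Qed.

Lemma emb_deg (G H : sgraph) (f : G -> H) : injective f ->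
  (forall x y, adj (f x) (f y) = adj x y) -> forall x, deg x <= deg (f x).
Proof.
move=> fi fA x; rewrite /deg -(card_imset _ fi); apply/subset_leq_card/subsetP.
by move=> _ /imsetP [y + ->]; rewrite !inE fA.
Qed.

(** * Comparing degree sequences *)

Lemma degseq_perm G H :
  degseq G = degseq H <-> perm_eq [seq deg x | x : G] [seq deg x | x : H].
Proof.
split; first by move=> e; rewrite -(perm_sort geq) -/(degseq G) e perm_sort.
move/perm_sortP; apply.
- by move=> x y; apply: leq_total.
- by move=> y x z le1 le2; apply: leq_trans le2 le1.
- by move=> x y le; apply: anti_leq; rewrite andbC.
Qed.

Lemma degseq_card G H : degseq G = degseq H -> #|G| = #|H|.
Proof. by move/degseq_perm/perm_size; rewrite !size_image. Qed.

(** A permutation matching the two degree lists pairs off vertices of equal degree; the pairing need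
    not respect adjacency. *)
Lemma degseq_inj G H : degseq G = degseq H ->
  exists2 f : G -> H, injective f & forall x, deg (f x) = deg x.
Proof.
move=> e; have cGH := degseq_card e.
(* Reading the list of vertices of [H] with [nth] needs a default vertex [y0], so the empty graph is
   treated apart. *)
case: (posnP #|G|) => [/card0_eq G0|].
  have no (x : G) : False by have := G0 x.
  by exists (fun x : G => False_rect H (no x)) => x; case: (no x).
rewrite cGH => /card_gt0P [y0 _].
have /degseq_perm /(perm_iotaP 0) [s ps es] := e.
rewrite size_image in ps.
have ss : size s = #|G| by rewrite (perm_size ps) size_iota.
have us : uniq s by rewrite (perm_uniq ps) iota_uniq.
have ltr (x : G) : index x (enum G) < #|G| by rewrite cardE index_mem mem_enum.
have lts (x : G) : nth 0 s (index x (enum G)) < #|H|.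
  have: nth 0 s (index x (enum G)) \in s by apply: mem_nth; rewrite ss.
  by rewrite (perm_mem ps) mem_iota.
exists (fun x => nth y0 (enum H) (nth 0 s (index x (enum G)))) => [x y|x].
  move/eqP; rewrite nth_uniq ?enum_uniq -?cardE //.
  rewrite nth_uniq ?ss // => /eqP eqi.
  by rewrite -(nth_index x (mem_enum predT x)) eqi nth_index ?mem_enum.
have := congr1 (fun t => nth 0 t (index x (enum G))) es.
rewrite (nth_map x) -?cardE // nth_index ?mem_enum // (nth_map 0) ?ss // => ->.
by rewrite (nth_map y0 0 (@deg H)) -?cardE.
Qed.

(** * Minimal graphs with a hereditary-upward property *)

Definition minimal_for (P : graph_set) : graph_set :=
  fun G => P G /\ forall H, emb H G -> P H -> #|G| <= #|H|.

Section MinimalFor.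
Variable P : graph_set.
Hypothesis P_emb : forall G H, emb G H -> P G -> P H.
Hypothesis P_deg : forall G H, degseq G = degseq H -> P G -> P H.

Lemma minimal_for_iso_closed : iso_closed (minimal_for P).
Proof.
move=> G H iGH [PG mG]; split; first exact: P_emb (iso_emb iGH) PG.
move=> K eK PK; have eHG := iso_emb (iso_sym iGH).
exact: leq_trans (emb_card eHG) (mG K (emb_trans eK eHG) PK).
Qed.

Lemma minimal_for_iso G H : P G -> emb G H -> minimal_for P H -> iso G H.
Proof. by move=> PG eGH [_ mH]; apply: emb_card_iso (mH _ _ _). Qed.

Lemma ex_minimal_for G : P G -> exists2 H, emb H G & minimal_for P H.
Proof.
have [n le] := ubnP #|G|; elim: n G le => // n IHn G leG PG.
case: (classic (minimal_for P G)) => [mG|nmG].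
  by exists G => //; apply/iso_emb/iso_refl.
case: (classic (exists H, [/\ emb H G, P H & #|H| < #|G|])) => [[H [eH PH lt]]|nex].
  have [|K eK mK] := IHn H _ PH; first exact: leq_trans lt leG.
  by exists K => //; apply: emb_trans eK eH.
case: nmG; split=> // H eH PH; rewrite leqNgt; apply/negP => lt.
by apply: nex; exists H.
Qed.

(** A graph contains a minimal [P]-graph exactly when it satisfies [P], and [P] depends on the
    degree sequence only. *)
Lemma minimal_for_DSF : DSF (minimal_for P).
Proof.
move=> d [G rG /freeP frG] H rH; apply/freeP => K mK eK.
have PG : P G by apply: (P_deg (etrans rH (esym rG))); apply: P_emb eK mK.1.
by have [L eL mL] := ex_minimal_for PG; apply: frG eL.
Qed.
End MinimalFor.

(** The contrapositive of DSF: containing some member of [F] passes between realizations, though the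
    member may change. *)
Lemma DSF_transfer (F : graph_set) G H K : DSF F -> degseq G = degseq H ->
  F K -> emb K G -> exists2 L, F L & emb L H.
Proof.
move=> dF dGH FK eK; apply: NNPP => nex.
have frH : free F H by apply/freeP => L FL eL; apply: nex; exists L.
by have /freeP /(_ K FK) := dF _ (ex_intro2 _ _ H erefl frH) G dGH.
Qed.

(** Here [minimal_for (emb G)] is the isomorphism class of [G], which has no proper nonempty
    isomorphism-closed subset. *)
Lemma minimal_DSF_emb G :
  (forall H K, degseq H = degseq K -> emb G H -> emb G K) ->
  exists F : graph_set, [/\ iso_closed F, minimal_DSF F & F G].
Proof.
move=> hdeg; exists (minimal_for (emb G)).
have memb H K : emb H K -> emb G H -> emb G K by move=> e1 e2; apply: emb_trans e2 e1.
have eG := iso_emb (iso_refl G).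
have mi H : minimal_for (emb G) H -> iso G H.
  by move=> mH; exact: (@minimal_for_iso (emb G) G H eG mH.1 mH).
split; first exact: minimal_for_iso_closed.
- split; first exact: minimal_for_DSF.
  move=> F' cF' [H F'H] [sub nsub] _; apply: nsub => K /mi iK.
  exact: cF' (iso_trans (iso_sym (mi _ (sub _ F'H))) iK) F'H.
- by split=> // H _ /emb_card.
Qed.

(** * Complementation *)

Section Complement.
Variable G : sgraph.

Definition compl_adj : rel G := fun x y => (x != y) && ~~ adj x y.

Lemma compl_sym : symmetric compl_adj.
Proof. by move=> x y; rewrite /compl_adj eq_sym adj_sym. Qed.

Lemma compl_irrefl : irreflexive compl_adj.
Proof. by move=> x; rewrite /compl_adj eqxx. Qed.

Definition compl : sgraph := SGraph compl_sym compl_irrefl.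

Lemma compl_deg (x : G) : @deg compl x = #|G|.-1 - deg x.
Proof.
rewrite /deg; have -> : [set y | @adj compl x y] = [set~ x] :\: [set y | adj x y].
  by apply/setP => y; rewrite !inE /= /compl_adj eq_sym andbC.
rewrite cardsDS ?cardsC1 //; apply/subsetP => y; rewrite !inE => axy.
by apply: contraTneq axy => ->; rewrite adj_irrefl.
Qed.
End Complement.

Lemma compl_compl G : iso (compl (compl G)) G.
Proof.
exists id; first by exists id.
move=> x y; rewrite /= /compl_adj /= /compl_adj negb_and !negbK.
by case: eqP => //= ->; rewrite adj_irrefl.
Qed.

Lemma compl_emb G H : emb G H -> emb (compl G) (compl H).
Proof.
move=> [f fi fA]; exists f => // x y.
by rewrite /= /compl_adj (inj_eq fi) fA.
Qed.

Lemma compl_iso G H : iso G H -> iso (compl G) (compl H).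
Proof.
move=> [f bf fA]; exists f => // x y.
by rewrite /= /compl_adj (inj_eq (bij_inj bf)) fA.
Qed.

Lemma compl_degseq G H : degseq G = degseq H -> degseq (compl G) = degseq (compl H).
Proof.
move=> e; apply/degseq_perm; have /degseq_perm p := e.
have E (K : sgraph) :
    [seq deg x | x : compl K] = [seq #|K|.-1 - d | d <- [seq deg x | x : K]].
  by rewrite -map_comp; apply: eq_map => x /=; rewrite compl_deg.
by rewrite !E (degseq_card e) perm_map.
Qed.

Lemma compl_DSF (F : graph_set) :
  iso_closed F -> DSF F -> DSF (fun G => F (compl G)).
Proof.
move=> cF dF d [G rG /freeP frG] H rH; apply/freeP => K FK eK.
have dHG : degseq (compl H) = degseq (compl G).
  by apply: compl_degseq; rewrite rG.
have [L FL eL] := DSF_transfer dF dHG FK (compl_emb eK).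
apply: (frG (compl L)); first exact: cF (iso_sym (compl_compl L)) FL.
exact: emb_trans (compl_emb eL) (iso_emb (compl_compl G)).
Qed.

Lemma compl_iso_closed (F : graph_set) :
  iso_closed F -> iso_closed (fun G => F (compl G)).
Proof. by move=> cF G H /compl_iso; apply: cF. Qed.

(** Complementing is an involution up to isomorphism, so a smaller DSF set on one side would give a
    smaller one on the other. *)
Lemma compl_minimal_DSF (F : graph_set) :
  iso_closed F -> minimal_DSF F -> minimal_DSF (fun G => F (compl G)).
Proof.
move=> cF [dF mF]; split; first exact: compl_DSF.
move=> F' cF' [H F'H] [sub nsub] dF'.
have cc G := iso_sym (compl_compl G).
apply: (mF _ (compl_iso_closed cF')) (compl_DSF cF' dF').
  by exists (compl H); apply: cF' (cc H) F'H.
split=> [G /sub|sub']; first exact: cF (compl_compl G).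
by apply: nsub => G /sub'; apply: cF' (compl_compl G).
Qed.

Lemma mem_minimal_DSF_compl G :
  (exists F : graph_set, [/\ iso_closed F, minimal_DSF F & F (compl G)]) ->
  exists F : graph_set, [/\ iso_closed F, minimal_DSF F & F G].
Proof.
move=> [F [cF mF FG]]; exists (fun H => F (compl H)).
by split=> //; [apply: compl_iso_closed | apply: compl_minimal_DSF].
Qed.

(** * Two graphs with equal degrees built from darts *)

(* The pair [inr (x, y)] with [x], [y] adjacent is the dart from [x] to [y].
   [dart_matching] adds to [G] the matching of each dart with its reverse,
   [dart_stars] attaches each dart as a leaf to its source; a pair that is not
   a dart is isolated in both. *)
Section DartGraphs.
Variable G : sgraph.

Definition dart_vertex : finType := (G + G * G)%type.

Definition dart_matching_adj : rel dart_vertex := fun u v =>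
  match u, v with
  | inl x, inl y => adj x y
  | inr p, inr q => adj p.1 p.2 && (q == (p.2, p.1))
  | _, _ => false
  end.

Definition dart_stars_adj : rel dart_vertex := fun u v =>
  match u, v with
  | inl x, inr p | inr p, inl x => adj p.1 p.2 && (x == p.1)
  | _, _ => false
  end.

Lemma dart_matching_sym : symmetric dart_matching_adj.
Proof.
move=> [x|[a b]] [y|[c d]] //=; first exact: adj_sym.
rewrite !xpair_eqE; apply/idP/idP;
  by case/and3P=> ab /eqP -> /eqP ->; rewrite adj_sym ab !eqxx.
Qed.

Lemma dart_matching_irrefl : irreflexive dart_matching_adj.
Proof.
move=> [x|[a b]] /=; first exact: adj_irrefl.
rewrite xpair_eqE; apply/negP => /and3P [ab /eqP e _].
by rewrite e adj_irrefl in ab.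
Qed.

Lemma dart_stars_sym : symmetric dart_stars_adj.
Proof. by case=> [x|p] []. Qed.

Lemma dart_stars_irrefl : irreflexive dart_stars_adj.
Proof. by case. Qed.

Definition dart_matching : sgraph := SGraph dart_matching_sym dart_matching_irrefl.
Definition dart_stars : sgraph := SGraph dart_stars_sym dart_stars_irrefl.

Lemma emb_dart_matching : emb G dart_matching.
Proof. by exists (inl : G -> dart_matching) => // x y []. Qed.

Lemma dart_matching_deg_inr p : @deg dart_matching (inr p) = adj p.1 p.2.
Proof.
rewrite /deg; case: (boolP (adj p.1 p.2)) => ap; last first.
  apply: eq_card0 => -[y|q]; by rewrite !inE //= (negbTE ap).
apply/eqP/cards1P; exists (inr (p.2, p.1)); apply/setP => -[y|q].
  by rewrite !inE.
by rewrite !inE /= ap.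
Qed.

Lemma dart_stars_deg_inr p : @deg dart_stars (inr p) = adj p.1 p.2.
Proof.
rewrite /deg; case: (boolP (adj p.1 p.2)) => ap; last first.
  apply: eq_card0 => -[y|q]; by rewrite !inE //= (negbTE ap).
apply/eqP/cards1P; exists (inl p.1); apply/setP => -[y|q]; last by rewrite !inE.
by rewrite !inE /= ap.
Qed.

Lemma dart_matching_deg_inl x : @deg dart_matching (inl x) = deg x.
Proof.
have i : injective (inl : G -> dart_vertex) by move=> ? ? [].
rewrite /deg -(card_imset _ i); apply: eq_card => -[y|q]; rewrite !inE /=.
  by rewrite mem_imset // inE.
by apply/esym/negbTE/negP => /imsetP [].
Qed.

Lemma dart_stars_deg_inl x : @deg dart_stars (inl x) = deg x.
Proof.
have i : injective (fun y => inr (x, y) : dart_vertex) by move=> ? ? [].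
rewrite /deg -(card_imset _ i); apply: eq_card => -[y|[a b]]; rewrite !inE /=.
  by apply/esym/negbTE/negP => /imsetP [].
apply/andP/imsetP => [[ab /eqP ->]|[y]]; first by exists b; rewrite ?inE.
by rewrite inE => ay [-> ->].
Qed.

(** Exactly [deg x] darts leave [x], and each dart has a single neighbour in either graph. *)
Lemma dart_degseq : degseq dart_matching = degseq dart_stars.
Proof.
rewrite /degseq; congr sort; apply: eq_map => -[x|p].
  by rewrite dart_matching_deg_inl dart_stars_deg_inl.
by rewrite dart_matching_deg_inr dart_stars_deg_inr.
Qed.
End DartGraphs.

(** * Graphs whose components are all stars *)

Definition star_forest (G : sgraph) : Prop :=
  forall x y : G, adj x y -> 1 < deg x -> deg y <= 1.

Lemma dart_stars_star_forest G : star_forest (dart_stars G).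
Proof.
move=> [x|p] [y|q] //= _; rewrite dart_stars_deg_inr; by case: adj.
Qed.

Lemma star_forest_emb G H : emb G H -> star_forest H -> star_forest G.
Proof.
move=> [f fi fA] sH x y axy dx; apply: leq_trans (emb_deg fi fA y) _.
by apply: (sH (f x)); [rewrite fA | apply: leq_trans dx (emb_deg fi fA x)].
Qed.

(** * Graphs dominating prescribed degrees *)

Section DegreeBound.
Variables (I : finType) (g : I -> nat).

(** An injective choice of vertices expresses termwise domination of degree sequences without
    sorting [g]. *)
Definition deg_dominates : graph_set := fun G =>
  exists2 f : I -> G, injective f & forall i, g i <= deg (f i).

Lemma deg_dominates_emb G H : emb G H -> deg_dominates G -> deg_dominates H.
Proof.
move=> [h hi hA] [f fi fg]; exists (h \o f); first exact: inj_comp.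
by move=> i; apply: leq_trans (fg i) (emb_deg hi hA _).
Qed.

Lemma deg_dominates_deg G H :
  degseq G = degseq H -> deg_dominates G -> deg_dominates H.
Proof.
move=> /degseq_inj [h hi hd] [f fi fg]; exists (h \o f); first exact: inj_comp.
by move=> i /=; rewrite hd.
Qed.

Definition star_vertex : finType := (I + {i : I & 'I_(g i)})%type.

Definition stars_adj : rel star_vertex := fun u v =>
  match u, v with
  | inl i, inr p | inr p, inl i => i == tag p
  | _, _ => false
  end.

Lemma stars_sym : symmetric stars_adj.
Proof. by case=> [x|p] []. Qed.

Lemma stars_irrefl : irreflexive stars_adj.
Proof. by case. Qed.

Definition stars : sgraph := SGraph stars_sym stars_irrefl.

Lemma deg_dominates_stars : deg_dominates stars.
Proof.
exists (inl : I -> stars) => [i j [] //|i].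
pose h (k : 'I_(g i)) : stars := inr (Tagged (fun i => 'I_(g i)) k).
have hi : injective h by move=> k l [] /eqP; rewrite eq_Tagged => /eqP.
rewrite -[X in X <= _]card_ord -(card_imset predT hi).
apply/subset_leq_card/subsetP => _ /imsetP [k _ ->].
by rewrite !inE /=.
Qed.

Hypothesis g_gt1 : forall i, 1 < g i.

(** The chosen vertices have degree at least 2, so they are star centres: they are pairwise
    nonadjacent, and each of their neighbours is adjacent to that centre alone. *)
Lemma stars_emb G : star_forest G -> deg_dominates G -> emb stars G.
Proof.
move=> sG [f fi fg].
have f_gt1 i : 1 < deg (f i) by apply: leq_trans (g_gt1 i) (fg i).
(* The first [g i] neighbours of [f i] in its enumerated neighbourhood. *)
pose leaf i (k : 'I_(g i)) : G := enum_val (widen_ord (fg i) k).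
have leafA i k : adj (f i) (@leaf i k).
  by have := enum_valP (widen_ord (fg i) k); rewrite inE.
have leaf_deg i k : deg (@leaf i k) <= 1 by apply: (sG (f i)).
have leaf1 i k x : adj x (@leaf i k) -> x = f i.
  move=> ax; have /card_le1_eqP := leaf_deg i k; apply; rewrite !inE adj_sym //.
have leaf_gt i k x : 1 < deg x -> (@leaf i k == x) = false.
  by apply: contraTF => /eqP <-; rewrite -leqNgt.
exists (fun u : stars => match u with inl i => f i | inr p => leaf (tag p) (tagged p) end).
  move=> [i|[i k]] [j|[j l]] //=.
  - by move=> /fi ->.
  - by move/esym/eqP; rewrite leaf_gt.
  - by move/eqP; rewrite leaf_gt.
  move=> e; have ij : i = j by apply/fi/(@leaf1 j l); rewrite -e.
  subst j; congr (inr (existT _ i _)).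
  by move/enum_val_inj/(congr1 val): e => /= /val_inj.
have key i j (k : 'I_(g j)) : adj (f i) (leaf j k) = (i == j).
  by apply/idP/eqP => [/leaf1/fi|->].
move=> [i|[i k]] [j|[j l]] /=.
- by apply: contraTF (f_gt1 j) => aij; rewrite -leqNgt; apply: sG aij _.
- exact: key.
- by rewrite adj_sym key.
apply/negP => /leaf1 e; have := leaf_deg i k.
by rewrite e leqNgt f_gt1.
Qed.

(* Dominating vertices have degree at least two, so the matching edges of
   [dart_matching G] contribute nothing to a minimal dominating subgraph. *)
Lemma minimal_dart_matching G H :
  minimal_for deg_dominates G -> minimal_for deg_dominates H ->
  emb H (dart_matching G) -> iso H G.
Proof.
move=> mG mH [h hi hA]; have [[f fi fg] _] := mH.
pose S : {set H} := [set x | if h x is inl _ then true else false].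
have hS x : 1 < deg x -> x \in S.
  move=> dx; rewrite inE; have := leq_trans dx (emb_deg hi hA x).
  by case: (h x) => // p; rewrite dart_matching_deg_inr; case: adj.
have nS x y : x \in S -> adj x y -> y \in S.
  by rewrite !inE -hA; case: (h x) => // a _; case: (h y).
have fS i : f i \in S by apply: hS; apply: leq_trans (g_gt1 i) (fg i).
(* [S] is the part of [H] lying over the copy of [G]. No edge leaves it, so the chosen vertices keep
   their degrees in it. *)
have dS : deg_dominates (induced S).
  exists (fun i => exist _ (f i) (fS i) : induced S) => [i j [] /fi //|i].
  apply: leq_trans (fg i) _; rewrite /deg.
  rewrite -[X in _ <= X](card_imset _ (@val_inj _ _ {x : H | x \in S})).
  apply/subset_leq_card/subsetP => y; rewrite inE => ay.
  apply/imsetP; exists (exist _ y (nS _ _ (fS i) ay)) => //.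
  by rewrite inE.
have eSG : emb (induced S) G.
  have hl (u : induced S) : exists x, h (val u) == inl x.
    by have := valP u; rewrite inE; case: (h _) => // x _; exists x.
  have [k hk] : exists k : induced S -> G, forall u, h (val u) = inl (k u).
    by exists (fun u => xchoose (hl u)) => u; apply/eqP/(xchooseP (hl u)).
  exists k => u v; first by move=> e; apply/val_inj/hi; rewrite !hk e.
  by rewrite /= /induced_adj -hA !hk.
have iSG := minimal_for_iso dS eSG mG.
have iSH := minimal_for_iso dS (induced_emb S) mH.
exact: iso_trans (iso_sym iSH) iSG.
Qed.

Lemma minimal_DSF_deg_dominates : minimal_DSF (minimal_for deg_dominates).
Proof.
split; first exact: minimal_for_DSF deg_dominates_emb deg_dominates_deg.
move=> F' cF' [H F'H] [sub nsub] dF'.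
have F'stars : F' stars.
  have [L F'L eL] := DSF_transfer dF' (dart_degseq H) F'H (emb_dart_matching H).
  (* As an induced subgraph of a star forest, [L] is one too, hence contains [stars]; its minimality
     makes the two isomorphic. *)
  have mL := sub _ F'L; have sL := star_forest_emb eL (@dart_stars_star_forest H).
  have eS := stars_emb sL mL.1.
  exact: cF' (iso_sym (minimal_for_iso deg_dominates_stars eS mL)) F'L.
apply: nsub => G mG.
have dG : deg_dominates (dart_stars G).
  apply: deg_dominates_deg (dart_degseq G) _.
  exact: deg_dominates_emb (emb_dart_matching G) mG.1.
have eS := stars_emb (@dart_stars_star_forest G) dG.
have [L F'L eL] := DSF_transfer dF' (esym (dart_degseq G)) F'stars eS.
exact: cF' (minimal_dart_matching mG (sub _ F'L) eL) F'L.
Qed.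
End DegreeBound.

(** * Placing a graph or its complement in such a family *)

(** A dominating induced subgraph must use every vertex of degree above 1 together with all its
    neighbours, and these exhaust [G]. *)
Lemma mem_minimal_DSF_gt1 (G : sgraph) :
  (forall x : G, 1 < deg x \/ exists2 y, adj x y & 1 < deg y) ->
  exists F : graph_set, [/\ iso_closed F, minimal_DSF F & F G].
Proof.
move=> hG; pose I : finType := {x : G | 1 < deg x}.
pose g (i : I) := deg (val i).
have g_gt1 i : 1 < g i by apply: valP i.
exists (minimal_for (deg_dominates g)); split.
- exact: minimal_for_iso_closed (@deg_dominates_emb I g).
- exact: minimal_DSF_deg_dominates.
split; first by exists val => //; apply: val_inj.
move=> H [h hi hA] [f fi fg].
have le1 i : deg (f i) <= deg (h (f i)) := emb_deg hi hA (f i).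
have c_gt1 i : 1 < deg (h (f i)).
  by apply: leq_trans (g_gt1 i) (leq_trans (fg i) (le1 i)).
pose c i : I := exist _ (h (f i)) (c_gt1 i).
have ci : injective c by move=> i j /(congr1 val) /= /hi /fi.
have le2 i : g i <= g (c i) := leq_trans (fg i) (le1 i).
(* [c] permutes the finite type [I], so [g] and its reindexing have equal sums; the termwise
   inequality is then an equality. *)
have eqg i : g i = g (c i).
  have [_] := leqif_sum (fun i (_ : true) => leqif_eq (le2 i)).
  by rewrite (reindex_inj ci) eqxx => /esym /forallP /(_ i) /eqP.
have eqd i : deg (h (f i)) = deg (f i).
  by apply/eqP; rewrite eqn_leq le1 andbT (leq_trans _ (fg i)) // eqg.
have c_onto x : 1 < deg x -> exists i, x = h (f i).
  move=> dx; have [c' _ c'K] := injF_bij ci.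
  by exists (c' (exist _ x dx)); have /(congr1 val) /= := c'K (exist _ x dx).
rewrite -(card_imset predT hi); apply/subset_leq_card/subsetP => x _.
case: (hG x) => [/c_onto [i ->]|[y axy /c_onto [i ey]]]; first exact: imset_f.
(* Equal degrees force the image of [H] to contain every neighbour of [h (f i)], in particular
   [x]. *)
have : h @: [set z | adj (f i) z] == [set z | adj (h (f i)) z].
  rewrite eqEcard card_imset // [X in _ && X](_ : _ = true) ?andbT; last first.
    by apply: eq_leq; apply: eqd.
  by apply/subsetP => _ /imsetP [z + ->]; rewrite !inE hA.
move/eqP/setP/(_ x); rewrite inE -ey adj_sym axy => /imsetP [z _ ->].
exact: imset_f.
Qed.

(** A vertex [x] violating the condition in [G] is isolated or lies in an isolated edge [xy]. In the
    complement, [x], respectively both [x] and [y], are joined to all remaining vertices, of which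
    there is at least one. *)
Lemma gt1_or_compl (G : sgraph) : 2 < #|G| ->
  (forall x : G, 1 < deg x \/ exists2 y, adj x y & 1 < deg y) \/
  (forall x : compl G, 1 < deg x \/ exists2 y, adj x y & 1 < deg y).
Proof.
move=> n3; case: (classic (forall x : G, 1 < deg x \/ exists2 y, adj x y & 1 < deg y)).
  by left.
move=> /not_all_ex_not [x /not_or_and [/negP dx ny]]; rewrite -leqNgt in dx; right.
have cA (u v : compl G) : u != v -> ~~ adj (u : G) v -> adj u v.
  by rewrite /= /compl_adj => -> ->.
case: (pickP (adj x)) => [y axy|x0]; last first.
  have dcx : 1 < @deg (compl G) x.
    rewrite compl_deg [deg x]eq_card0 ?subn0 ?ltn_predRL // => y.
    by rewrite !inE x0.
  move=> z; case: (eqVneq z x) => [->|zx]; first by left.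
  by right; exists x => //; apply: cA; rewrite // adj_sym x0.
have dy : deg y <= 1 by rewrite leqNgt; apply/negP => dy; apply: ny; exists y.
have nx z : adj x z -> z = y by move=> az; have /card_le1_eqP := dx; apply; rewrite inE.
have nyx z : adj y z -> z = x.
  by move=> az; have /card_le1_eqP := dy; apply; rewrite inE // adj_sym.
have xy : x != y by apply: contraTneq axy => ->; rewrite adj_irrefl.
have cx z : z != y -> z != x -> @adj (compl G) x z.
  by move=> zy zx; apply: cA; [rewrite eq_sym | apply: contraNN zy => /nx ->].
have cy z : z != y -> z != x -> @adj (compl G) y z.
  by move=> zy zx; apply: cA; [rewrite eq_sym | apply: contraNN zx => /nyx ->].
have dz (z : compl G) : z != y -> z != x -> 1 < deg z.
  move=> zy zx; have <- : #|[set x; y]| = 2 by rewrite cards2 xy.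
  apply/subset_leq_card/subsetP => u; rewrite !inE (@adj_sym (compl G)).
  by case/orP=> /eqP ->; [apply: cx | apply: cy].
have [z zy zx] : exists2 z, z != y & z != x.
  have : 0 < #|~: [set x; y]| by rewrite cardsCs setCK cards2 xy subn_gt0.
  by case/card_gt0P => z; rewrite !inE negb_or => /andP [zx zy]; exists z.
move=> u; case: (eqVneq u x) => [->|ux]; first by right; exists z; [apply: cx | apply: dz].
case: (eqVneq u y) => [->|uy]; first by right; exists z; [apply: cy | apply: dz].
by left; apply: dz.
Qed.

(** * Graphs on at most two vertices *)

(** Containing [G] only requires enough vertices, and the degree sequence fixes their number. *)
Lemma mem_minimal_DSF_card_le1 (G : sgraph) : #|G| <= 1 ->
  exists F : graph_set, [/\ iso_closed F, minimal_DSF F & F G].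
Proof.
move=> n1; apply: minimal_DSF_emb => H K /degseq_inj [h hi _] [f fi _].
exists (h \o f) => [|x y]; first exact: inj_comp.
by have /card_le1_eqP /(_ x y isT isT) -> := n1; rewrite !adj_irrefl.
Qed.

(** Containing an edge means having a vertex of positive degree. *)
Lemma mem_minimal_DSF_edge (G : sgraph) (a b : G) : #|G| = 2 -> adj a b ->
  exists F : graph_set, [/\ iso_closed F, minimal_DSF F & F G].
Proof.
move=> n2 ab; apply: minimal_DSF_emb => H K /degseq_inj [h _ hd] [f fi fA].
have : 0 < deg (h (f a)).
  by rewrite hd; apply/card_gt0P; exists (f b); rewrite inE fA.
case/card_gt0P => k; rewrite inE => ak.
have nab : a != b by apply: contraTneq ab => ->; rewrite adj_irrefl.
have GE (x : G) : x = a \/ x = b.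
  have /setP /(_ x) : [set a; b] = setT.
    by apply/eqP; rewrite eqEcard subsetT cardsT n2 cards2 nab.
  by rewrite !inE => /orP [] /eqP; [left | right].
have nk : h (f a) != k by apply: contraTneq ak => ->; rewrite adj_irrefl.
have ba : (b == a) = false by rewrite eq_sym (negbTE nab).
exists (fun x => if x == a then h (f a) else k) => x y.
  case: (GE x) (GE y) => -> [] -> //; rewrite eqxx ba.
    by move/eqP; rewrite (negbTE nk).
  by move/esym/eqP; rewrite (negbTE nk).
case: (GE x) (GE y) => -> [] ->; rewrite ?eqxx ?ba ?adj_irrefl //.
  by rewrite ab.
by rewrite adj_sym ak adj_sym ab.
Qed.

Theorem theorem2p12 (G : sgraph) :
  exists F : graph_set, [/\ iso_closed F, minimal_DSF F & F G].
Proof.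
case: (ltngtP #|G| 2) => [n1|n3|n2]; first exact: mem_minimal_DSF_card_le1.
  case: (gt1_or_compl n3) => /mem_minimal_DSF_gt1 //.
  exact: mem_minimal_DSF_compl.
have /eqP/cards2P [a [b [nab _]]] : #|[set: G]| = 2 by rewrite cardsT.
case: (boolP (adj a b)) => ab; first exact: mem_minimal_DSF_edge n2 ab.
apply/mem_minimal_DSF_compl/(@mem_minimal_DSF_edge (compl G) a b n2).
by rewrite /= /compl_adj nab.
Qed.
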